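(* Let $X$ be a non-degenerate real random variable such that $\varphi(t):=\log \mathbb{E}[e^{tX}]$ is finite for all $t\ge 0$, let $c_1:=\varphi'(1)-\varphi(1)$, and let $f_-(c)=\varphi(1)+c$ and $f_+(c)=I^{-1}(c)$. Then $f_-(c_1)=f_+(c_1)$ and $f_-'(c_1)=f_+'(c_1)$, but $f_-''(c_1)\ne f_+''(c_1)$.
   Context: Non-degenerate means not almost surely constant. Under the hypothesis on $\varphi$, $\varphi$ is infinitely differentiable and strictly convex on $(0,\infty)$. Let $\beta_0:=\lim_{t\to0+}\varphi'(t)=\mathbb{E}X$ and $\beta_\infty:=\lim_{t\to+\infty}\varphi'(t)=\operatorname{ess\,sup}X$ (possibly $\beta_0=-\infty$ or $\beta_\infty=+\infty$). The function $I:(\beta_0,+\infty)\to(0,+\infty]$ is defined by $I(\beta)=\sup_{t\ge0}(\beta t-\varphi(t))$. On $(\beta_0,\beta_\infty)$ it is finite, strictly increasing, strictly convex and infinitely differentiable; $I^{-1}$ is the inverse of its restriction to this interval. It is defined in a neighborhood of $c_1=I(\varphi'(1))$. *)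

(* Defs.v *)
From HB Require Import structures.
From mathcomp Require Import all_boot all_order all_algebra.
From mathcomp Require Import all_classical all_reals all_analysis.
Import Order.TTheory GRing.Theory Num.Theory.
Import numFieldNormedType.Exports.

Set Implicit Arguments.
Unset Strict Implicit.
Unset Printing Implicit Defensive.

Local Open Scope ring_scope.
Local Open Scope classical_set_scope.

Definition degenerate (d : measure_display) (T : measurableType d)
    (R : realType) (P : probability T R) (X : T -> R) : Prop :=
  exists a : R, {ae P, forall w, X w = a}.

(* [log E[exp (t X)]], with value [+oo] when the expectation diverges. *)
Definition ecgf (d : measure_display) (T : measurableType d) (R : realType)
    (P : probability T R) (X : T -> R) (t : R) : \bar R :=
  lne ('M_P X t).

(* Meaningful only where [ecgf P X] is finite. *)
Definition cgf (d : measure_display) (T : measurableType d) (R : realType)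
    (P : probability T R) (X : T -> R) (t : R) : R :=
  fine (ecgf P X t).

Section Rate.
Variables (R : realType) (phi : R -> R).

Definition beta0 : \bar R := lim ((derive1 phi t)%:E @[t --> 0^'+]).

Definition beta_infty : \bar R := lim ((derive1 phi t)%:E @[t --> +oo]).

Definition rate (b : R) : \bar R :=
  ereal_sup [set (b * t - phi t)%:E | t in [set t : R | 0 <= t]].

Definition rate_dom : set R := [set b | (beta0 < b%:E < beta_infty)%E].

(* Inverse of the restriction of [rate] to [rate_dom]; outside the image
   [rate @` rate_dom] its value is unspecified. *)
Definition rate_inv : \bar R -> R := pinv rate_dom rate.

Definition f_minus (c : R) : R := phi 1 + c.

Definition f_plus (c : R) : R := rate_inv c%:E.

End Rate.

Definition twice_derivable_at (R : realType) (f : R -> R) (x : R) : Prop :=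
  (\forall y \near x, derivable f y 1) /\ derivable (derive1 f) x 1.

(* Main.v *)
(* Write phi for the cumulant generating function and h t := t phi' t - phi t.
   Differentiating the moments E[X^k exp (t X)] under the integral sign gives
   phi' and phi'' on (0, +oo), and phi'' > 0 because it is the variance of X
   under the exponentially tilted law, which vanishes only if X is constant
   almost surely. The tangent inequality for phi gives I (phi' t) = h t, so
   f_+ (h t) = phi' t. As h' t = t phi'' t > 0, the chain rule yields
   f_+' (h t) = 1 / t and then f_+'' (h t) = - 1 / (t^3 phi'' t). At t = 1
   these are 1 and - 1 / phi'' 1 <> 0, whereas f_-' = 1 and f_-'' = 0. *)

Require Import Defs.
From HB Require Import structures.
From mathcomp Require Import all_boot all_order all_algebra.
From mathcomp Require Import all_classical all_reals all_analysis.
From mathcomp Require Import measurable_realfun ring lra.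
Import Order.TTheory GRing.Theory Num.Theory.
Import numFieldNormedType.Exports.

Local Open Scope ring_scope.
Local Open Scope classical_set_scope.

(** * Exponential domination of powers *)

Lemma expr_le_factM_expR {R : realType} (k : nat) (x : R) :
  0 <= x -> x ^+ k <= k`!%:R * expR x.
Proof.
case: k => [|k] x0; first by rewrite expr0 mul1r -expR0 ler_expR.
rewrite mulrC -ler_pdivrMr ?ltr0n ?fact_gt0//.
by apply: le_trans (expR_ge1Dxn k x0); rewrite lerDr.
Qed.

(* The two terms dominate the left side on [x < 0] and on [0 <= x],
   respectively. *)
Lemma moment_expR_bound {R : realType} (k : nat) (u v s x : R) :
  0 < u -> u <= s -> s <= v ->
  `|x ^+ k * expR (s * x)|
    <= k`!%:R / u ^+ k + k`!%:R * expR ((v + 1) * x).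
Proof.
move=> u0 us sv; rewrite normrM (ger0_norm (expR_ge0 _)) normrX.
have k0 : 0 <= k`!%:R :> R by rewrite ler0n.
have [x0|x0] := leP 0 x.
  apply: ler_wpDl; first by rewrite divr_ge0// exprn_ge0// ltW.
  (* The power costs one factor [expR x], whence the [1] in [v + 1]. *)
  rewrite ger0_norm// mulrDl mul1r addrC expRD mulrA.
  apply: ler_pM; rewrite ?exprn_ge0 ?expR_ge0//.
    exact: expr_le_factM_expR.
  by rewrite ler_expR ler_wpM2r.
apply: ler_wpDr; first by rewrite mulr_ge0// expR_ge0.
rewrite ltr0_norm// ler_pdivlMr ?exprn_gt0//.
(* For negative [x] the decay of [expR (u * x)] beats the power, by the factorial bound at
   [u * - x]. *)
have ux0 : 0 <= u * - x by rewrite mulr_ge0 ?oppr_ge0 // ltW.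
have := expr_le_factM_expR k _ ux0.
rewrite mulrN expRN ler_pdivlMr ?expR_gt0// -mulrN exprMn => h.
apply: le_trans h; rewrite mulrC mulrA ler_wpM2l//.
  by rewrite mulr_ge0// exprn_ge0 ?oppr_ge0// ltW.
by rewrite ler_expR ler_wnM2r// ltW.
Qed.

(** * Moments of [X] weighted by [expR (t * X)] *)

Section exponential_moments.
Context {d} {T : measurableType d} {R : realType} (P : probability T R).
Context (X : {RV P >-> R}).
Hypothesis integrable_expR : forall t : R, 0 <= t ->
  P.-integrable setT (EFin \o (fun x => expR (t * X x))).

Definition expmoment (k : nat) (t : R) : R :=
  \int[P]_x (X x ^+ k * expR (t * X x)).

(** A majorant common to all exponents in [[u, v]], for dominated differentiation under the integral
    sign. *)
Let bound k (u v : R) x : R :=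
  k`!%:R / u ^+ k + k`!%:R * expR ((v + 1) * X x).

Let integrable_bound k (u v : R) : 0 <= v ->
  P.-integrable setT (EFin \o bound k u v).
Proof.
move=> v0; rewrite /bound /comp; under eq_fun do rewrite EFinD.
apply: integrableD => //; first exact: finite_measure_integrable_cst.
under eq_fun do rewrite EFinM.
by apply: integrableZl => //; apply: integrable_expR; rewrite addr_ge0.
Qed.

(** For [0 < t] the weight tames large negative values of [X]; at [t = 0] even the mean of [X] may
    be infinite. *)
Lemma integrable_expmoment k (t : R) : 0 < t ->
  P.-integrable setT (EFin \o (fun x => X x ^+ k * expR (t * X x))).
Proof.
move=> t0.
apply: (le_integrable measurableT _ _ (integrable_bound k t t (ltW t0))).
  apply/measurable_EFinP/measurable_funM; first exact: measurable_funX.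
  by apply/measurableT_comp => //; exact: measurable_funM.
move=> x _; rewrite /= lee_fin.
apply: (le_trans (moment_expR_bound k t t t (X x) t0 (lexx _) (lexx _))).
exact: ler_norm.
Qed.

Let integrableZ_expmoment (c : R) k t : 0 < t ->
  P.-integrable setT (EFin \o (fun x => c * (X x ^+ k * expR (t * X x)))).
Proof.
move=> t0; rewrite /comp; under eq_fun do rewrite EFinM.
by apply: integrableZl => //; exact: integrable_expmoment.
Qed.

Let expmomentZ (c : R) k t : 0 < t ->
  \int[P]_x (c * (X x ^+ k * expR (t * X x))) = c * expmoment k t.
Proof. by move=> t0; rewrite RintegralZl//; exact: integrable_expmoment. Qed.

Lemma is_derive_expmoment k (t : R) : 0 < t ->
  is_derive t 1 (expmoment k) (expmoment k.+1 t).
Proof.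
move=> t0.
pose f s x := X x ^+ k * expR (s * X x).
have der (s : R) x : is_derive s 1 (f^~ x) (X x ^+ k.+1 * expR (s * X x)).
  rewrite /f; apply: is_derive_eq; rewrite /GRing.scale/= exprSr; ring.
have df (s : R) x : partial1of2 f s x = X x ^+ k.+1 * expR (s * X x).
  rewrite partial1of2E; exact: derive_val.
have ut : t / 2 < t by rewrite ltr_pdivrMr// mulr_natr mulr2n ltrDl.
have u0 : 0 < t / 2 by rewrite divr_gt0.
(* Exponents stay in []t / 2, t + 1[], away from 0: the majorant grows without bound as its lower
   end tends to 0. *)
have main := @cvg_differentiation_under_integral R _ _ P f setT measurableT
  t (t / 2) (t + 1) _ _ _ (bound k.+1 (t / 2) (t + 1)) _ _ _.
have {}main : h^-1 *: (expmoment k (h + t) - expmoment k t) @[h --> 0^'] -->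
    expmoment k.+1 t.
  rewrite [X in _ --> X](_ : _ = \int[P]_y partial1of2 f t y); last first.
    by apply: eq_Rintegral => y _; rewrite df.
  apply: main => /=.
  - by rewrite in_itv/= ut ltrDl ltr01.
  - move=> s; rewrite in_itv/= => /andP[us _].
    by apply: integrable_expmoment; exact: lt_trans us.
  - by move=> s x _ _; apply: ex_derive.
  - move=> x; rewrite /bound addr_ge0// ?mulr_ge0 ?expR_ge0//.
    by rewrite invr_ge0 exprn_ge0// ltW.
  - by apply: integrable_bound; rewrite addr_ge0// ltW.
  - move=> s x; rewrite in_itv/= => /andP[us sv] _; rewrite df.
    by apply: moment_expR_bound; rewrite ?ltW.
have {}main : h^-1 *: (expmoment k (h *: 1 + t) - expmoment k t)
    @[h --> 0^'] --> expmoment k.+1 t.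
  by under eq_fun do rewrite /GRing.scale/= mulr1.
apply: DeriveDef; first by apply/cvg_ex; exists (expmoment k.+1 t).
exact: cvg_lim main.
Qed.

(** With a zero integral the exponential would vanish almost everywhere; since it never vanishes, a
    null set would be the whole space. *)
Lemma expmoment0_gt0 (t : R) : 0 <= t -> 0 < expmoment 0 t.
Proof.
move=> t0; have := integrable_expR t t0.
have mX : measurable_fun setT (EFin \o (fun x => expR (t * X x))).
  by apply/measurable_EFinP/measurableT_comp => //; exact: measurable_funM.
rewrite /expmoment /Rintegral; under eq_integral do rewrite expr0 mul1r.
move=> /integrable_fin_num ifin; rewrite fine_gt0// ltey_eq ifin// andbT.
rewrite lt0e integral_ge0 ?andbT; last by move=> x _; rewrite lee_fin expR_ge0.
apply/eqP => i0.
have := (@ae_eq_integral_abs _ _ _ P setT measurableT _ mX).1.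
rewrite (_ : (\int[P]_(x in setT) _)%E = 0%E); last first.
  rewrite -[RHS]i0; apply: eq_integral => x _ /=.
  by rewrite ger0_norm ?expR_ge0.
move=> /(_ erefl) [N [mN N0 sub]].
have : (P setT <= P N)%E.
  apply: le_measure; rewrite ?inE// => x _; apply: sub => /= /(_ I).
  by move=> [] /eqP; rewrite expR_eq0.
by rewrite probability_setT N0 lee_fin ler10.
Qed.

(* Jensen for the measure with density proportional to [exp (t X)], whose mean
   of [X] is [m]; the tangent bound used is
   [exp ((s - t) x) >= exp ((s - t) m) (1 + (s - t) (x - m))]. *)
Lemma expmoment0_tangent (s t : R) : 0 <= s -> 0 < t ->
  expR ((s - t) * (expmoment 1 t / expmoment 0 t)) * expmoment 0 t
    <= expmoment 0 s.
Proof.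
move=> s0 t0; have M0 := expmoment0_gt0 t (ltW t0).
set m := expmoment 1 t / _.
(* [a + b * x] is the tangent bound as an affine function of [x]. Since [m] is the tilted mean, its
   weighted integral is exactly the left side. *)
pose a := expR ((s - t) * m) * (1 - (s - t) * m).
pose b := expR ((s - t) * m) * (s - t).
have -> : expR ((s - t) * m) * expmoment 0 t =
    \int[P]_x (a * (X x ^+ 0 * expR (t * X x)) +
               b * (X x ^+ 1 * expR (t * X x))).
  rewrite RintegralD ?expmomentZ//; try exact: integrableZ_expmoment.
  rewrite /a /b.
  have -> : expmoment 1 t = m * expmoment 0 t by rewrite /m divfK// gt_eqF.
  ring.
apply: le_Rintegral => //.
- rewrite /comp; under eq_fun do rewrite EFinD.
  by apply: integrableD => //; exact: integrableZ_expmoment.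
- rewrite /comp; under eq_fun do rewrite expr0 mul1r.
  exact: integrable_expR.
move=> x _; rewrite expr0 expr1 mul1r.
have -> : s * X x = (s - t) * m + t * X x + (s - t) * (X x - m) by ring.
rewrite !expRD.
have := expR_ge1Dx ((s - t) * (X x - m)).
rewrite -(ler_pM2l (mulr_gt0 (expR_gt0 ((s - t) * m)) (expR_gt0 (t * X x)))).
rewrite mul1r; apply: le_trans; rewrite /a /b le_eqVlt; apply/orP; left.
apply/eqP; ring.
Qed.

(* The difference of the two sides, divided by [expmoment 0 t], is the integral
   of [(X - m)^2 exp (t X)] for [m = expmoment 1 t / expmoment 0 t]. *)
Lemma expmoment_cauchy_schwarz (t : R) : 0 < t -> ~ degenerate P X ->
  expmoment 1 t ^+ 2 < expmoment 0 t * expmoment 2 t.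
Proof.
move=> t0 ndX; have M0 := expmoment0_gt0 t (ltW t0).
set m := expmoment 1 t / expmoment 0 t.
pose f x := (X x - m) ^+ 2 * expR (t * X x).
have fE : f = fun x => (1 * (X x ^+ 2 * expR (t * X x)) +
    (- (2 * m)) * (X x ^+ 1 * expR (t * X x))) +
    m ^+ 2 * (X x ^+ 0 * expR (t * X x)).
  by apply/funext => x; rewrite /f expr0 expr1; ring.
have iD : P.-integrable setT (EFin \o (fun x =>
    1 * (X x ^+ 2 * expR (t * X x)) +
    (- (2 * m)) * (X x ^+ 1 * expR (t * X x)))).
  rewrite /comp; under eq_fun do rewrite EFinD.
  by apply: integrableD => //; exact: integrableZ_expmoment.
have fi : P.-integrable setT (EFin \o f).
  rewrite fE /comp; under eq_fun do rewrite EFinD.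
  by apply: integrableD iD _ => //; exact: integrableZ_expmoment.
have If : \int[P]_x f x =
    (expmoment 0 t * expmoment 2 t - expmoment 1 t ^+ 2) / expmoment 0 t.
  rewrite fE !RintegralD// ?expmomentZ//; try exact: integrableZ_expmoment.
  rewrite /m; field.
  by rewrite gt_eqF.
rewrite -subr_gt0 -(pmulr_lgt0 _ (_ : 0 < (expmoment 0 t)^-1)) ?invr_gt0//.
rewrite -If lt_neqAle Rintegral_ge0 ?andbT; last first.
  by move=> x _; rewrite /f mulr_ge0 ?expR_ge0 ?sqr_ge0.
(* A zero integral of [f] forces [X = m] almost surely. *)
apply/eqP => I0; apply: ndX; exists m.
have mf : measurable_fun setT (EFin \o f) by case/integrableP : fi.
have := (@ae_eq_integral_abs _ _ _ P setT measurableT _ mf).1.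
rewrite (_ : (\int[P]_(x in setT) _)%E = 0%E); last first.
  rewrite [RHS](_ : _ = (\int[P]_x f x)%:E); last by rewrite -I0.
  rewrite /Rintegral fineK; last exact: integrable_fin_num.
  apply: eq_integral => x _ /=.
  by rewrite ger0_norm// /f mulr_ge0 ?expR_ge0 ?sqr_ge0.
move=> /(_ erefl); apply: filterS => x /(_ I) [] /eqP.
by rewrite mulf_eq0 expR_eq0 orbF sqrf_eq0 subr_eq0 => /eqP.
Qed.

End exponential_moments.

(** * Legendre duality on the positive half-line *)

Lemma is_derive_gt0_incr {R : realType} (f f1 : R -> R) :
  (forall t : R, 0 < t -> is_derive t 1 f (f1 t)) ->
  (forall t : R, 0 < t -> 0 < f1 t) ->
  forall s t : R, 0 < s -> s < t -> f s < f t.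
Proof.
move=> df f10 s t s0 st.
have sub z : z \in `[s, t]%R -> 0 < z.
  by rewrite in_itv/= => /andP[sz _]; exact: lt_le_trans sz.
have cf : {within `[s, t], continuous f}.
  by apply: derivable_within_continuous => z /sub/df[].
have [z zst e] := MVT st (fun z zst => df z (sub z (subset_itv_oo_cc zst))) cf.
rewrite -subr_gt0 e mulr_gt0 ?subr_gt0// f10// sub//.
exact: subset_itv_oo_cc.
Qed.

Section legendre.
Context {R : realType} (phi phi1 phi2 : R -> R).
Hypothesis is_derive_phi : forall t : R, 0 < t -> is_derive t 1 phi (phi1 t).
Hypothesis is_derive_phi1 : forall t : R, 0 < t -> is_derive t 1 phi1 (phi2 t).
Hypothesis phi2_gt0 : forall t : R, 0 < t -> 0 < phi2 t.
(** The case [s = 0] is included because the supremum in [rate] ranges over the closed half-line,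
    whereas derivatives are given only inside. *)
Hypothesis phi_tangent : forall s t : R, 0 <= s -> 0 < t ->
  phi t + phi1 t * (s - t) <= phi s.

Let derive1_phi (t : R) : 0 < t -> derive1 phi t = phi1 t.
Proof. by move=> t0; rewrite derive1E; have [] := is_derive_phi t t0. Qed.

(* The Legendre transform of [phi] at the slope [phi1 t]. *)
Definition legendre (t : R) : R := t * phi1 t - phi t.

Lemma is_derive_legendre (t : R) : 0 < t -> is_derive t 1 legendre (t * phi2 t).
Proof.
move=> t0; have d0 := is_derive_phi _ t0; have d1 := is_derive_phi1 _ t0.
apply: is_derive_eq; rewrite /GRing.scale/=; ring.
Qed.

Let phi1_incr (s t : R) : 0 < s -> s < t -> phi1 s < phi1 t.
Proof. exact: (is_derive_gt0_incr _ _ is_derive_phi1 phi2_gt0). Qed.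

Let legendre_incr (s t : R) : 0 < s -> s < t -> legendre s < legendre t.
Proof.
apply: (is_derive_gt0_incr _ _ is_derive_legendre) => r r0.
by rewrite mulr_gt0// phi2_gt0.
Qed.

Let legendre_inj (s t : R) : 0 < s -> 0 < t -> legendre s = legendre t -> s = t.
Proof.
move=> s0 t0 e; have [st|ts|//] := ltgtP s t.
  by have := legendre_incr _ _ s0 st; rewrite e ltxx.
by have := legendre_incr _ _ t0 ts; rewrite e ltxx.
Qed.

Let phi1_le (s t : R) : 0 < s -> s <= t -> phi1 s <= phi1 t.
Proof.
by move=> s0; rewrite le_eqVlt => /predU1P[->//|/(phi1_incr _ _ s0)/ltW].
Qed.

(** By monotonicity of [phi1], the right limit at 0 is an infimum, possibly [-oo]. *)
Lemma beta0E : beta0 phi = ereal_inf ((EFin \o phi1) @` `]0, +oo[).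
Proof.
apply: cvg_lim => //.
suff : (phi1 t)%:E @[t --> 0^'+] --> ereal_inf ((EFin \o phi1) @` `]0, +oo[).
  apply: cvg_trans; apply: near_eq_cvg.
  by near=> t; rewrite derive1_phi.
apply: (@nondecreasing_at_right_cvge _ (EFin \o phi1) 0 +oo%O) => // s t.
rewrite !in_itv/= !andbT => s0 t0 st; rewrite lee_fin; exact: phi1_le.
Unshelve. all: by end_near. Qed.

(* Monotone only on the positive half-line, [phi1] is replaced by a function
   that is monotone everywhere and agrees with it near [+oo]. *)
Lemma beta_inftyE : beta_infty phi = ereal_sup ((EFin \o phi1) @` `]0, +oo[).
Proof.
pose g t := phi1 (Num.max 1 t).
have -> : ereal_sup ((EFin \o phi1) @` `]0, +oo[) =
    ereal_sup (range (EFin \o g)).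
  apply/eqP; rewrite eq_le.
  apply/andP; split; apply: ge_ereal_sup => _ [t /= t0 <-].
    apply: (@le_trans _ _ (g t)%:E); last by apply: ereal_sup_ubound; exists t.
    move: t0; rewrite in_itv/= andbT => t0.
    by rewrite lee_fin phi1_le// le_max lexx orbT.
  apply: ereal_sup_ubound; exists (Num.max 1 t) => //=.
  by rewrite in_itv/= andbT lt_max ltr01.
apply: cvg_lim => //.
suff : (g t)%:E @[t --> +oo] --> ereal_sup (range (EFin \o g)).
  apply: cvg_trans; apply: near_eq_cvg.
  near=> t.
  have t1 : 1 <= t by near: t; apply: nbhs_pinfty_ge.
  by rewrite /g max_r// derive1_phi// (lt_le_trans ltr01).
apply: nondecreasing_cvge => s t st; rewrite lee_fin phi1_le//.
  by rewrite lt_max ltr01.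
by rewrite ge_max !le_max lexx st orbT.
Unshelve. all: by end_near. Qed.

(** One inclusion is the intermediate value theorem for [phi1]. For the other, strict growth from
    [t / 2] to [t] to [t + 1] shows that neither extreme is attained. *)
Lemma rate_domE : rate_dom phi = phi1 @` `]0, +oo[.
Proof.
apply/seteqP; split=> [b|_ [t /= + <-]].
all: rewrite /rate_dom /= beta0E beta_inftyE.
  move=> /andP[/ereal_inf_lt[_ [s /= + <-]] + /ereal_sup_gt[_ [t /= + <-]]].
  rewrite !in_itv/= !andbT !lte_fin => s0 sb t0 bt.
  have st : s <= t.
    rewrite leNgt; apply/negP => /(phi1_incr _ _ t0).
    by rewrite ltNge (ltW (lt_trans sb bt)).
  have cf : {within `[s, t], continuous phi1}.
    apply: derivable_within_continuous => z; rewrite in_itv/= => /andP[sz _].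
    by have [] := is_derive_phi1 z (lt_le_trans s0 sz).
  have /(_ b) [|z] :=
    segment_continuous_le_surjective st (phi1_le _ _ s0 st) cf.
    by rewrite /= in_itv/= !ltW.
  rewrite /= in_itv/= => /andP[sz _] zb; exists z => //=.
  by rewrite in_itv/= andbT (lt_le_trans s0).
rewrite in_itv/= andbT => t0; apply/andP; split.
  apply: (@le_lt_trans _ _ (phi1 (t / 2))%:E).
    apply: ereal_inf_lbound; exists (t / 2) => //=.
    by rewrite in_itv/= andbT divr_gt0.
  rewrite lte_fin phi1_incr// ?divr_gt0//.
  by rewrite ltr_pdivrMr// mulr_natr mulr2n ltrDl.
apply: (@lt_le_trans _ _ (phi1 (t + 1))%:E).
  by rewrite lte_fin phi1_incr// ltrDl.
apply: ereal_sup_ubound; exists (t + 1) => //=.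
by rewrite in_itv/= andbT addr_gt0.
Qed.

Lemma rate_phi1 (t : R) : 0 < t -> rate phi (phi1 t) = (legendre t)%:E.
Proof.
move=> t0; apply/eqP; rewrite eq_le; apply/andP; split.
  apply: ge_ereal_sup => _ [s /= s0 <-]; rewrite lee_fin /legendre.
  have := phi_tangent s t s0 t0; lra.
by apply: ereal_sup_ubound; exists t; rewrite /= ?ltW// /legendre mulrC.
Qed.

Lemma f_plus_legendre (t : R) : 0 < t -> f_plus phi (legendre t) = phi1 t.
Proof.
move=> t0; rewrite /f_plus /rate_inv -rate_phi1// pinvKV//; last first.
  by rewrite inE rate_domE; exists t => //=; rewrite in_itv/= andbT.
(* Injectivity of [rate] on its domain, needed to cancel [pinv], reduces to that of [legendre]. *)
move=> b c; rewrite !inE rate_domE => -[r /= + <-] [s /= + <-].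
rewrite !in_itv/= !andbT => r0 s0; rewrite !rate_phi1// => -[].
by move/legendre_inj => ->.
Qed.

(** This turns identities along values of [legendre] into identities on a neighborhood, so that
    derivatives can be transferred. *)
Lemma near_legendre (t : R) : 0 < t ->
  \forall c \near legendre t, exists2 s, 0 < s & legendre s = c.
Proof.
move=> t0.
have u0 : 0 < t / 2 by rewrite divr_gt0.
have ut : t / 2 < t by rewrite ltr_pdivrMr// mulr_natr mulr2n ltrDl.
have tv : t < t + 1 by rewrite ltrDl.
have uv := lt_trans ut tv.
have cf : {within `[t / 2, t + 1], continuous legendre}.
  apply: derivable_within_continuous => z; rewrite in_itv/= => /andP[sz _].
  by have [] := is_derive_legendre z (lt_le_trans u0 sz).
near=> c.
have /(_ c) [|z] :=
  segment_continuous_le_surjective (ltW uv) (ltW (legendre_incr _ _ u0 uv)) cf.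
  rewrite /= in_itv/=; apply/andP; split; apply: ltW; near: c.
    by apply: lt_nbhsr; exact: legendre_incr.
  by apply: lt_nbhsl; exact: legendre_incr.
rewrite /= in_itv/= => /andP[sz _] zb; exists z => //.
exact: lt_le_trans sz.
Unshelve. all: by end_near. Qed.

(** Recovers the parameter [t]; near values of [legendre], [f_plus phi] factors as
    [phi1 \o legendre_inv]. *)
Definition legendre_inv : R -> R := pinv (`]0, +oo[%classic : set R) legendre.

Lemma legendreK (t : R) : 0 < t -> legendre_inv (legendre t) = t.
Proof.
move=> t0; apply: pinvKV; last by rewrite inE/= in_itv/= andbT.
move=> r s; rewrite !inE/= !in_itv/= !andbT; exact: legendre_inj.
Qed.

Lemma is_derive_legendre_inv (t : R) : 0 < t ->
  is_derive (legendre t) 1 legendre_inv (t * phi2 t)^-1.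
Proof.
move=> t0; apply: is_derive_inverse.
- by near=> s; apply: legendreK; near: s; exact: lt_nbhsr.
- near=> s; apply/differentiable_continuous/derivable1_diffP.
  have s0 : 0 < s by near: s; exact: lt_nbhsr.
  by have [] := is_derive_legendre s s0.
- exact: is_derive_legendre.
- by rewrite gt_eqF// mulr_gt0// phi2_gt0.
Unshelve. all: by end_near. Qed.

(** The factor [phi2 t] cancels in the chain rule. *)
Lemma is_derive_f_plus (t : R) : 0 < t ->
  is_derive (legendre t) 1 (f_plus phi) t^-1.
Proof.
move=> t0; have p0 := phi2_gt0 _ t0.
apply: (@near_eq_is_derive _ _ _ (phi1 \o legendre_inv)).
  apply: filterS (near_legendre _ t0) => _ [s s0 <-].
  by rewrite /= legendreK// f_plus_legendre.
have di := is_derive_legendre_inv _ t0.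
have dp : is_derive (legendre_inv (legendre t)) 1 phi1 (phi2 t).
  by rewrite legendreK//; exact: is_derive_phi1.
apply: is_derive_eq (is_derive1_comp dp di) _.
by rewrite invfM mulrCA divff ?mulr1// gt_eqF.
Qed.

(** Near [legendre t] the first derivative is the reciprocal of [legendre_inv], so no third
    derivative of [phi] enters. *)
Lemma is_derive_derive1_f_plus (t : R) : 0 < t ->
  is_derive (legendre t) 1 (derive1 (f_plus phi)) (- (t ^+ 3 * phi2 t)^-1).
Proof.
move=> t0; have p0 := phi2_gt0 _ t0.
apply: (@near_eq_is_derive _ _ _ (fun c => (legendre_inv c)^-1)).
  apply: filterS (near_legendre _ t0) => _ [s s0 <-].
  rewrite /= legendreK// derive1E.
  by have [_ ->] := is_derive_f_plus _ s0.
have di := is_derive_legendre_inv _ t0.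
apply: is_derive_eq.
  by apply: is_deriveV di; rewrite legendreK// gt_eqF.
rewrite legendreK// /GRing.scale/=; field.
by rewrite !gt_eqF.
Qed.

End legendre.

(** * The cumulant generating function as the logarithm of a moment *)

Section cgf.
Context {d} {T : measurableType d} {R : realType} (P : probability T R).
Context (X : {RV P >-> R}).
Hypothesis cgf_finite : forall t : R, 0 <= t -> ecgf P X t \is a fin_num.

Lemma mmt_gen_funE (t : R) :
  'M_P X t = (\int[P]_x (expR (t * X x))%:E)%E.
Proof.
rewrite /mmt_gen_fun unlock; apply: eq_integral => x _ /=.
by rewrite mulrC.
Qed.

(** [lne] sends [+oo] to [+oo], so a finite logarithm excludes a divergent integral. *)
Lemma ecgf_finite_integrable (t : R) : 0 <= t ->
  P.-integrable setT (EFin \o (fun x => expR (t * X x))).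
Proof.
move=> t0; apply/integrableP; split.
  by apply/measurable_EFinP/measurableT_comp => //; exact: measurable_funM.
under eq_integral => x _ do rewrite /= ger0_norm ?expR_ge0//.
have := cgf_finite t t0; rewrite /ecgf mmt_gen_funE.
by case: (integral _ _ _) => //= r _; rewrite ltry.
Qed.

Let M := expmoment P X.

Let M0_gt0 t : 0 <= t -> 0 < M 0 t.
Proof. exact: expmoment0_gt0 ecgf_finite_integrable t. Qed.

Lemma cgfE (t : R) : 0 <= t -> cgf P X t = ln (M 0 t).
Proof.
move=> t0; have := M0_gt0 t t0.
rewrite /cgf /ecgf mmt_gen_funE /M /expmoment /Rintegral.
under [X in ln (fine X)]eq_integral do rewrite expr0 mul1r.
under [X in 0 < fine X]eq_integral do rewrite expr0 mul1r.
rewrite -(fineK (integrable_fin_num _ (ecgf_finite_integrable t t0)))//.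
by move=> Mt; rewrite lne_EFin.
Qed.

Lemma is_derive_cgf (t : R) : 0 < t ->
  is_derive t 1 (cgf P X) (M 1 t / M 0 t).
Proof.
move=> t0; have Mt := M0_gt0 t (ltW t0).
apply: (@near_eq_is_derive _ _ _ (@ln R \o M 0)).
  by near=> s; rewrite cgfE// ltW//; near: s; exact: lt_nbhsr.
have dM := is_derive_expmoment P X ecgf_finite_integrable 0 t t0.
apply: is_derive_eq (is_derive1_comp (is_derive1_ln Mt) dM) _.
by rewrite mulrC.
Unshelve. all: by end_near. Qed.

(** The value is the variance of [X] under the tilted law. *)
Lemma is_derive2_cgf (t : R) : 0 < t ->
  is_derive t 1 (fun s => M 1 s / M 0 s)
    ((M 0 t * M 2 t - M 1 t ^+ 2) / M 0 t ^+ 2).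
Proof.
move=> t0; have Mt := M0_gt0 t (ltW t0).
have dM0 : is_derive t 1 (M 0) (M 1 t).
  exact: is_derive_expmoment ecgf_finite_integrable 0 t t0.
have dM1 : is_derive t 1 (M 1) (M 2 t).
  exact: is_derive_expmoment ecgf_finite_integrable 1 t t0.
have Mt0 : M 0 t != 0 by rewrite gt_eqF.
apply: is_derive_eq (is_deriveM dM1 (is_deriveV Mt0 dM0)) _.
by rewrite /GRing.scale/=; field.
Qed.

(** The logarithm of [expmoment0_tangent]. *)
Lemma cgf_tangent (s t : R) : 0 <= s -> 0 < t ->
  cgf P X t + M 1 t / M 0 t * (s - t) <= cgf P X s.
Proof.
move=> s0 t0; have Mt := M0_gt0 t (ltW t0).
rewrite (cgfE t (ltW t0)) (cgfE s s0) addrC mulrC -[X in X + _]expRK.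
rewrite -lnM ?posrE ?expR_gt0//.
rewrite ler_ln ?posrE ?mulr_gt0 ?expR_gt0 ?(M0_gt0 s s0)//.
exact: expmoment0_tangent ecgf_finite_integrable s t s0 t0.
Qed.

End cgf.

Theorem proposition1 (d : measure_display) (T : measurableType d)
    (R : realType) (P : probability T R) (X : {RV P >-> R})
    (X_nondegenerate : ~ degenerate P X)
    (cgf_finite : forall t : R, 0 <= t -> ecgf P X t \is a fin_num) :
  let phi := cgf P X in
  let c1 := derive1 phi 1 - phi 1 in
  let fm := f_minus phi in
  let fp := f_plus phi in
  [/\ (* [fp] is defined near [c1], and both functions are twice
         differentiable at [c1] *)
      (\forall c \near c1, (rate phi @` rate_dom phi) c%:E),
      twice_derivable_at fm c1 /\ twice_derivable_at fp c1,
      fm c1 = fp c1,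
      derive1 fm c1 = derive1 fp c1
    & derive1n 2 fm c1 <> derive1n 2 fp c1].
Proof.
move=> phi c1 fm fp.
pose M := expmoment P X.
have d1 t t0 := is_derive_cgf P X cgf_finite t t0.
have d2 t t0 := is_derive2_cgf P X cgf_finite t t0.
have M0 (t : R) : 0 < t -> 0 < M 0 t.
  move=> /ltW; apply: expmoment0_gt0.
  exact: ecgf_finite_integrable.
have d2_gt0 t : 0 < t -> 0 < (M 0 t * M 2 t - M 1 t ^+ 2) / M 0 t ^+ 2.
  move=> t0; rewrite divr_gt0 ?exprn_gt0 ?M0// subr_gt0.
  by apply: expmoment_cauchy_schwarz => // s; exact: ecgf_finite_integrable.
have tangent := cgf_tangent P X cgf_finite.
pose phi1 t := M 1 t / M 0 t.
have dphi : derive1 phi 1 = phi1 1.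
  by rewrite derive1E; have [_ ->] := d1 1 ltr01.
(* All the duality results are now read at the parameter [1]. *)
have c1E : c1 = legendre phi phi1 1 by rewrite /c1 dphi /legendre mul1r.
have dfp t t0 := is_derive_f_plus phi phi1 _ d1 d2 d2_gt0 tangent t t0.
have d2fp := is_derive_derive1_f_plus phi phi1 _ d1 d2 d2_gt0 tangent 1 ltr01.
have near1 := near_legendre phi phi1 _ d1 d2 d2_gt0 1 ltr01.
have dfm (c : R) : is_derive c 1 fm 1.
  rewrite (_ : fm = cst (phi 1) + id); last exact/funext.
  by apply: is_derive_eq; rewrite add0r.
have dfmE : derive1 fm = cst 1.
  by apply/funext => c; rewrite derive1E; have [_ ->] := dfm c.
have dfp1 : is_derive c1 1 fp 1.
  by rewrite c1E; apply: is_derive_eq (dfp 1 ltr01) _; rewrite invr1.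
split.
- rewrite c1E; apply: filterS near1 => _ [t t0 <-].
  exists (phi1 t); last exact: rate_phi1.
  rewrite (rate_domE phi phi1 _ d1 d2 d2_gt0).
  by exists t => //=; rewrite in_itv/= andbT.
- split; split.
  + by apply: (@filterE _ (nbhs c1)) => c; have [] := dfm c.
  + by rewrite dfmE; exact: derivable_cst.
  + rewrite c1E; apply: filterS near1 => _ [t t0 <-].
    by have [] := dfp t t0.
  + by rewrite c1E; have [] := d2fp.
- rewrite /fp c1E (f_plus_legendre phi phi1 _ d1 d2 d2_gt0 tangent)// -c1E.
  by rewrite /fm /f_minus /c1 dphi addrC subrK.
- by rewrite dfmE derive1E; have [_ ->] := dfp1.
(* The left side is 0, the right side minus the inverse of the positive tilted variance at [1]. *)
- rewrite /derive1n /= dfmE derive1_cst derive1E c1E.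
  have [_ ->] := d2fp => /eqP; rewrite eq_sym oppr_eq0 invr_eq0.
  by rewrite gt_eqF// mulr_gt0// d2_gt0.
Qed.
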